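(* Let $G$ be a nontrivial connected finite simple graph with $m$ edges that contains $t$ pairwise edge-disjoint triangles. Then $$src(G)\le m-2t,$$ and equality holds if and only if $G\in\overline{\mathcal{G}}_t$.
   Context: All graphs are finite, undirected and simple. An edge-coloring of $G$ is any assignment of colors to the edges (adjacent edges may receive the same color). A path is rainbow if no two of its edges have the same color. A rainbow $u-v$ geodesic is a rainbow $u-v$ path of length $d(u,v)$, the distance between $u$ and $v$. An edge-colored connected graph is strongly rainbow connected if for every two vertices $u,v$ there exists a rainbow $u-v$ geodesic. The strong rainbow connection number $src(G)$ of a connected graph $G$ is the minimum number of colors in an edge-coloring that makes $G$ strongly rainbow connected. A block of a connected graph is a maximal connected subgraph without a cut vertex (so each block is a maximal 2-connected subgraph or a bridge). A connected graph $G$ belongs to the class $\overline{\mathcal{G}}_t$ if: (1) each block of $G$ is a bridge or a triangle; (2) $G$ contains exactly $t$ triangles; (3) each triangle of $G$ contains at least one vertex of degree two in $G$. *)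

(* Defs.v *)
From mathcomp Require Import all_boot.
Set Implicit Arguments.
Unset Strict Implicit.
Unset Printing Implicit Defensive.

Record sgraph := SGraph {
  svertex :> finType;
  adj : rel svertex;
  adj_sym : symmetric adj;
  adj_irrefl : irreflexive adj }.

Definition edges (G : sgraph) : {set {set G}} :=
  [set f | [exists x, exists y, adj x y && (f == [set x; y])]].

Notation edge G := {f : {set svertex G} | f \in edges G}.

Definition degree (G : sgraph) (x : G) : nat := #|[set y | adj x y]|.

Definition connected (G : sgraph) : bool :=
  [forall x : G, forall y : G, connect (@adj G) x y].

(* A path from u to v is given by u and the sequence p of its other vertices,
   so that its length is size p. *)
Definition uvpath (G : sgraph) (u v : G) (p : seq G) : bool :=
  [&& path (@adj G) u p, last u p == v & uniq (u :: p)].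

(* A path has fewer than #|G| edges; the value is #|G| when u and v are not
   joined by any path. *)
Definition dist (G : sgraph) (u v : G) : nat :=
  find (fun k => [exists p : k.-tuple G, uvpath u v p]) (iota 0 #|G|).

Definition path_edges (G : sgraph) (u : G) (p : seq G) : seq {set G} :=
  pairmap (fun x y => [set x; y]) u p.

(* The edges of a path are pairwise distinct, so it suffices to compare the
   colors of distinct edges. *)
Definition rainbow (G : sgraph) (k : nat) (c : {ffun edge G -> 'I_k})
    (u : G) (p : seq G) : bool :=
  [forall f : edge G, forall g : edge G,
    [&& f != g, val f \in path_edges u p & val g \in path_edges u p]
    ==> (c f != c g)].

Definition strongly_rainbow_connected (G : sgraph) (k : nat)
    (c : {ffun edge G -> 'I_k}) : bool :=
  [forall u : G, forall v : G, exists p : (dist u v).-tuple G,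
    uvpath u v p && rainbow c u p].

Definition strongly_rainbow_colorable (G : sgraph) (k : nat) : bool :=
  [exists c : {ffun edge G -> 'I_k}, strongly_rainbow_connected c].

Lemma geodesic_exists (G : sgraph) (u v : G) :
  connect (@adj G) u v -> exists p : (dist u v).-tuple G, uvpath u v p.
Proof.
case/connectP=> q /shortenP[p pP pU _] ->.
set d := dist _ _; apply/existsP.
pose a k := [exists q : k.-tuple G, uvpath u (last u p) q].
have szp : size p < #|G| by rewrite -[(size p).+1]/(size (u :: p)) -(card_uniqP pU) max_card.
have aH : has a (iota 0 #|G|).
  apply/hasP; exists (size p); first by rewrite mem_iota.
  by apply/existsP; exists (in_tuple p); rewrite /uvpath pP pU eqxx.
have := nth_find 0 aH; rewrite nth_iota ?add0n //.
by move: aH; rewrite has_find size_iota.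
Qed.

Lemma strongly_rainbow_colorable_exists (G : sgraph) :
  connected G -> exists k, strongly_rainbow_colorable G k.
Proof.
move=> /forallP Gc; exists #|{: edge G}|; apply/existsP.
exists [ffun f => enum_rank f].
apply/forallP=> u; apply/forallP=> v.
have [p pP] := geodesic_exists (forallP (Gc u) v).
apply/existsP; exists p; rewrite pP /=.
apply/forallP=> f; apply/forallP=> g; apply/implyP=> /and3P[nfg _ _].
by rewrite !ffunE (inj_eq enum_rank_inj).
Qed.

Definition src (G : sgraph) (Gc : connected G) : nat :=
  ex_minn (strongly_rainbow_colorable_exists Gc).

(* A subgraph is a pair of a vertex set and an edge set. *)
Definition pregraph (G : sgraph) : Type := ({set G} * {set {set G}})%type.

Definition is_subgraph (G : sgraph) (H : pregraph G) : bool :=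
  (H.2 \subset edges G) && [forall f in H.2, f \subset H.1].

Definition whole (G : sgraph) : pregraph G := (setT, edges G).

Definition sub_adj (G : sgraph) (H : pregraph G) : rel G :=
  [rel x y | [set x; y] \in H.2].

Definition sub_connected (G : sgraph) (H : pregraph G) : bool :=
  (H.1 != set0) &&
  [forall x in H.1, forall y in H.1, connect (sub_adj H) x y].

Definition del_vertex (G : sgraph) (H : pregraph G) (v : G) : pregraph G :=
  (H.1 :\ v, [set f in H.2 | v \notin f]).

Definition del_edge (G : sgraph) (H : pregraph G) (f : {set G}) : pregraph G :=
  (H.1, H.2 :\ f).

(* H' is obtained from H by a deletion, and it has two vertices which were in
   the same component of H but no longer are in H'. *)
Definition separates (G : sgraph) (H H' : pregraph G) : bool :=
  [exists x in H'.1, exists y in H'.1,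
    connect (sub_adj H) x y && ~~ connect (sub_adj H') x y].

Definition cut_vertex (G : sgraph) (H : pregraph G) (v : G) : bool :=
  (v \in H.1) && separates H (del_vertex H v).

Definition bridge (G : sgraph) (f : {set G}) : bool :=
  (f \in edges G) && separates (whole G) (del_edge (whole G) f).

Definition nonseparable (G : sgraph) (H : pregraph G) : bool :=
  [&& is_subgraph H, sub_connected H & [forall v, ~~ cut_vertex H v]].

Definition block (G : sgraph) (H : pregraph G) : Prop :=
  nonseparable H /\
  forall H' : pregraph G, nonseparable H' ->
    H.1 \subset H'.1 -> H.2 \subset H'.2 -> H' = H.

(* A triangle is represented by its vertex set, which determines it. *)
Definition triangle (G : sgraph) (T : {set G}) : bool :=
  (#|T| == 3) && [forall x in T, forall y in T, (x != y) ==> adj x y].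

Definition edges_in (G : sgraph) (W : {set G}) : {set {set G}} :=
  [set f in edges G | f \subset W].

Definition edge_disjoint_triangles (G : sgraph) (D : {set {set G}}) : Prop :=
  (forall T, T \in D -> triangle T) /\
  (forall T T', T \in D -> T' \in D -> T != T' ->
    [disjoint edges_in T & edges_in T']).

Definition class_Gbar (t : nat) (G : sgraph) : Prop :=
  [/\ connected G,
      forall H : pregraph G, block H ->
        (exists2 f, bridge f & H = (f, [set f])) \/
        (exists2 T, triangle T & H = (T, edges_in T)),
      #|[set T : {set G} | triangle T]| = t &
      forall T : {set G}, triangle T -> exists2 x, x \in T & degree x = 2].

(* Main.v *)
(* Fix edge-disjoint triangles forming D.  The class of an edge is the triangle
   of D containing it, or the edge itself; there are m - 2t classes, each of them
   a clique, so giving each class one color makes every geodesic rainbow.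

   One color can be saved, by giving up one class and moving its edges to other
   classes, in three situations:
   - some triangle abq is not in D: the only geodesics that cease to be rainbow
     pass through a and can be rerouted through b;
   - some triangle of D has an edge leaving it at each vertex: an edge of the
     triangle takes the class of the edge leaving it at the opposite vertex;
   - some edge ab lies on a cycle avoiding the other edges of its class: in a
     shortest such cycle, which is isometric, two antipodal edges may share a
     color.  The triangles attached to them have an apex of degree two, and one
     of the two edges at the apex takes the color of the next edge of the cycle.

   Otherwise the classes are the blocks and G is in the class.  Conversely, if
   the blocks are bridges or triangles with a vertex of degree two, choose in
   each triangle the edge opposite to such a vertex: any two of the m - 2t chosen
   edges and bridges lie on all geodesics between some pair of vertices, so they
   have distinct colors. *)
Require Import Defs.
From mathcomp Require Import all_boot zify.
Set Implicit Arguments.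
Unset Strict Implicit.
Unset Printing Implicit Defensive.

(** * Distances and geodesics *)

Section Metric.
Variables (G : sgraph) (Gc : connected G).
Implicit Types (x y z u v : G) (p : seq G).

Lemma dist_geodesic u v :
  exists p, [/\ path (@adj G) u p, last u p = v & size p = dist u v].
Proof.
have [p /and3P[pP /eqP pv _]] := geodesic_exists (forallP (forallP Gc u) v).
by exists p; rewrite size_tuple.
Qed.

(** Cutting out loops turns a walk into a path that is no longer, and [find] stops at the least
    length of a path. *)
Lemma dist_le_size u p : path (@adj G) u p -> dist u (last u p) <= size p.
Proof.
case/shortenP=> q qP qU sqp.
apply: (@leq_trans (size q)); last first.
  by case/andP: qU => _ /uniq_leq_size; apply.
rewrite leqNgt; apply/negP=> lt_q.
have lt_qG : size q < #|G|.
  by rewrite -[(size q).+1]/(size (u :: q)) -(card_uniqP qU) max_card.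
have := before_find 0 lt_q; rewrite nth_iota // add0n => /existsP; apply.
exists (in_tuple q).
by rewrite /uvpath qP qU eqxx.
Qed.

Lemma distxx x : dist x x = 0.
Proof. by have := @dist_le_size x [::] isT; case: dist. Qed.

Lemma dist_eq0 x y : (dist x y == 0) = (x == y).
Proof.
apply/eqP/eqP=> [d0|->]; last exact: distxx.
by have [[|z p] [_ /= py]] := dist_geodesic x y; rewrite ?d0.
Qed.

Lemma dist_triangle y x z : dist x z <= dist x y + dist y z.
Proof.
have [p [pP py <-]] := dist_geodesic x y.
have [q [qP qz <-]] := dist_geodesic y z.
rewrite -size_cat -qz -py -last_cat; apply: dist_le_size.
by rewrite cat_path pP py.
Qed.

Lemma distC x y : dist x y = dist y x.
Proof.
wlog suff le : x y / dist x y <= dist y x.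
  by apply/eqP; rewrite eqn_leq !le.
have [p [pP py <-]] := dist_geodesic y x.
have := @dist_le_size (last y p) (rev (belast y p)).
rewrite size_rev size_belast rev_path => /(_ _).
have -> : last (last y p) (rev (belast y p)) = y.
  by case: (p) => //= z r; rewrite rev_cons last_rcons.
rewrite py; apply.
by apply: sub_path pP => u v /=; rewrite adj_sym.
Qed.

Lemma adj_neq x y : adj x y -> x != y.
Proof. by apply: contraTneq => ->; rewrite adj_irrefl. Qed.

Lemma dist_adj x y : adj x y -> dist x y = 1.
Proof.
move=> xy; have := @dist_le_size x [:: y]; rewrite /= xy => /(_ isT).
by have := dist_eq0 x y; rewrite (negPf (adj_neq xy)); case: dist => [|[]].
Qed.

Lemma dist_first_step x y : x != y ->
  exists2 z, adj x z & dist x y = (dist z y).+1.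
Proof.
have [[|z p] [/= + py sp]] := dist_geodesic x y; first by rewrite py eqxx.
case/andP=> xz pP _; exists z => //.
have := dist_le_size pP; have := dist_triangle z x y.
by rewrite (dist_adj xz) py; lia.
Qed.

Definition geodesic u p := path (@adj G) u p && (size p == dist u (last u p)).

(** Each of the three pieces is at most as long as its number of steps, and the total is a distance,
    so every bound is attained. *)
Lemma geodesic_nth u p i j : geodesic u p -> i <= j <= size p ->
  dist (nth u (u :: p) i) (nth u (u :: p) j) = j - i.
Proof.
case/andP=> pP /eqP sp /andP[le_ij le_jp].
have step l : l < size p ->
    dist (nth u (u :: p) l) (nth u (u :: p) l.+1) = 1.
  by move=> lp; apply: dist_adj; have /pathP-/(_ u l lp) := pP.
have le a b : a <= b <= size p ->
    dist (nth u (u :: p) a) (nth u (u :: p) b) <= b - a.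
  case/andP; elim: b => [|b IH]; first by case: a => // _ _; rewrite distxx.
  rewrite leq_eqVlt => /predU1P[-> _|ab bp]; first by rewrite distxx.
  have := dist_triangle (nth u (u :: p) b) (nth u (u :: p) a) (nth u (u :: p) b.+1).
  by rewrite step //; have := IH ab (ltnW bp); lia.
have nth_end : nth u (u :: p) (size p) = last u p by rewrite (last_nth u).
have H1 := le 0 i; have H2 := le i j; have H3 := le j (size p).
have := dist_triangle (nth u (u :: p) i) u (last u p).
have := dist_triangle (nth u (u :: p) j) (nth u (u :: p) i) (last u p).
rewrite nth_end /= in H1 H3.
by move: H1 H2 H3; rewrite -sp; lia.
Qed.

Lemma path_edgesP u p f :
  reflect (exists2 i, i < size p &
             f = [set nth u (u :: p) i; nth u (u :: p) i.+1])
          (f \in path_edges u p).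
Proof.
rewrite /path_edges.
apply: (iffP (nthP set0)) => [[i]|[i ip ->]]; rewrite ?size_pairmap.
  by move=> ip <-; exists i; rewrite ?(nth_pairmap u).
by exists i; rewrite ?size_pairmap // (nth_pairmap u).
Qed.

(* Two edges that a geodesic traverses as [x -> x' ... y' -> y] satisfy the
   hypothesis on distances; conversely every such quadruple lies on one. *)
Definition crossing x x' y' y :=
  [&& adj x x', adj y' y & dist x y == (dist x' y').+2].

Lemma crossing_sym x x' y' y : crossing x x' y' y = crossing y y' x' x.
Proof.
by rewrite /crossing andbCA [adj x x']adj_sym [adj y' y]adj_sym
  (distC x) (distC x').
Qed.

Definition rainbow_label (L : eqType) (h : {set G} -> L) u p :=
  {in path_edges u p &, forall f g, f != g -> h f != h g}.

(** A label repeated at positions [i < j] yields a crossing. The last equation lets the part from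
    [x] to [y] be replaced by another one of the same length. *)
Lemma rainbow_labelVcrossing (L : eqType) (h : {set G} -> L) u p :
  geodesic u p ->
  rainbow_label h u p \/
  exists x x' y' y, [/\ crossing x x' y' y, h [set x; x'] = h [set y'; y],
    [/\ x \in u :: p, x' \in u :: p, y' \in u :: p & y \in u :: p] &
    dist u (last u p) = dist u x + dist x y + dist y (last u p)].
Proof.
move=> gp.
case: (boolP [exists i : 'I_(size p), exists j : 'I_(size p), (i < j) &&
   (h [set nth u (u :: p) i; nth u (u :: p) i.+1] ==
    h [set nth u (u :: p) j; nth u (u :: p) j.+1])]) => [|N]; last first.
  left=> f g /path_edgesP[i ip ->] /path_edgesP[j jp ->] neq.
  apply: contra N => /eqP hh.
  have [ij|ji|eqij] := ltngtP i j; last by rewrite eqij eqxx in neq.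
    by apply/existsP; exists (Ordinal ip); apply/existsP;
       exists (Ordinal jp); rewrite /= ij hh eqxx.
  by apply/existsP; exists (Ordinal jp); apply/existsP;
     exists (Ordinal ip); rewrite /= ji hh eqxx.
case/existsP=> i /existsP[j /andP[ij /eqP hij]]; right.
have mem l : l <= size p -> nth u (u :: p) l \in u :: p.
  by move=> lp; apply: mem_nth.
have ip := ltn_ord i; have jp := ltn_ord j.
have D := geodesic_nth gp.
have /andP[pP /eqP sp] := gp.
exists (nth u (u :: p) i), (nth u (u :: p) i.+1),
       (nth u (u :: p) j), (nth u (u :: p) j.+1).
split=> //; last 1 first.
- have := D 0 i; have := D j.+1 (size p); have := D 0 (size p).
  have := D i j.+1.
  have -> : nth u (u :: p) (size p) = last u p by rewrite (last_nth u).
  by rewrite [nth u (u :: p) 0]/=; move: ij ip jp; clear; lia.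
- apply/and3P; split; try by move/pathP: pP; apply.
  by rewrite !D; move: ij ip jp; clear; lia.
- by split; apply: mem; rewrite // ltnW.
Qed.

Lemma geodesic_pos u p z : geodesic u p -> z \in u :: p ->
  z = nth u (u :: p) (dist u z).
Proof.
move=> gp /(nthP u)[i ip <-].
by have /= -> := @geodesic_nth u p 0 i gp ip; rewrite subn0.
Qed.

(* A geodesic on which a label repeats is rerouted through [b]: the new one avoids
   [a], so no label repeats on it. *)
Lemma rainbow_geodesic_reroute (L : eqType) (h : {set G} -> L) a b u v :
  a != b ->
  (forall x x' y' y, crossing x x' y' y -> h [set x; x'] = h [set y'; y] ->
    [/\ x' = a, y' = a, adj x b & adj b y]) ->
  exists p, [/\ geodesic u p, last u p = v & rainbow_label h u p].
Proof.
move=> ab hab.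
have rb p : geodesic u p -> a \notin u :: p -> rainbow_label h u p.
  move=> gp ap; have [//|] := rainbow_labelVcrossing h gp.
  case=> x [x'] [y'] [y] [cr hh [_ x'p _ _] _].
  by case: (hab _ _ _ _ cr hh) => ea _ _ _; rewrite -ea x'p in ap.
have [p [pP pv sp]] := dist_geodesic u v.
have gp : geodesic u p by rewrite /geodesic pP sp pv eqxx.
have [|] := rainbow_labelVcrossing h gp; first by exists p.
case=> x [x'] [y'] [y] [cr hh _].
have [ex' ey' xb bY] := hab _ _ _ _ cr hh.
rewrite pv => duv.
have /and3P[axx' _ /eqP dxy] := cr; subst x' y'.
rewrite distxx in dxy.
have [q [qP qx sq]] := dist_geodesic u x.
have [r [rP rv sr]] := dist_geodesic y v.
have lq : last u (q ++ [:: b, y & r]) = v by rewrite last_cat.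
have gq : geodesic u (q ++ [:: b, y & r]).
  rewrite /geodesic lq cat_path qP qx /= xb bY rP size_cat /= sq sr duv dxy.
  by apply/eqP; lia.
exists (q ++ [:: b, y & r]); split=> //.
apply: rb => //; apply/negP=> /(geodesic_pos gq).
(* A vertex of a geodesic sits at the index equal to its distance from [u]; for [a] this index is
   taken by [b]. *)
suff -> : dist u a = (dist u x).+1.
  by rewrite /= nth_cat sq ltnn subnn => /eqP; apply/negP.
have := dist_triangle x u a; have := dist_triangle a u v.
have := dist_triangle y a v.
have := cr; rewrite /crossing => /and3P[xa ay _].
by rewrite (dist_adj xa) (dist_adj ay); lia.
Qed.

Lemma rainbow_geodesic (L : eqType) (h : {set G} -> L) u v :
  (forall x x' y' y, crossing x x' y' y -> h [set x; x'] != h [set y'; y]) ->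
  exists p, [/\ geodesic u p, last u p = v & rainbow_label h u p].
Proof.
move=> hh; have [p [pP pv sp]] := dist_geodesic u v.
have gp : geodesic u p by rewrite /geodesic pP sp pv eqxx.
exists p; split=> //; have [//|] := rainbow_labelVcrossing h gp.
by case=> x [x'] [y'] [y] [/hh/eqP].
Qed.

(** Numbering the set [A] turns labels into colors. *)
Lemma src_le_card (L : finType) (h : {set G} -> L) (A : {set L}) :
  {in edges G, forall f, h f \in A} ->
  (forall u v, exists p,
     [/\ geodesic u p, last u p = v & rainbow_label h u p]) ->
  src Gc <= #|A|.
Proof.
move=> hA hR; rewrite /src; case: ex_minnP => k _; apply.
pose c (f : edge G) := enum_rank_in (hA _ (valP f)) (h (val f)).
apply/existsP; exists [ffun f => c f].
apply/forallP=> u; apply/forallP=> v.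
have [p [/andP[pP /eqP sp] pv pR]] := hR u v.
rewrite pv in sp; apply/existsP.
(* Different positions on a geodesic are at positive distance. *)
have pU : uniq (u :: p).
  apply/(uniqP u) => i j; rewrite !inE /= !ltnS => ip jp eij.
  have gp : geodesic u p by rewrite /geodesic pP sp pv eqxx.
  wlog ij : i j ip jp eij / i <= j.
    by move=> W; case/orP: (leq_total i j) => /W; [|symmetry]; auto.
  have := geodesic_nth gp (i := i) (j := j); rewrite ij jp => /(_ isT).
  by rewrite eij distxx; lia.
have sz : size p == dist u v by apply/eqP.
exists (Tuple sz); rewrite /uvpath pP pv eqxx pU /=.
apply/forallP=> f; apply/forallP=> g; apply/implyP=> /and3P[fg fp gp].
rewrite !ffunE; apply: contraNneq (pR _ _ fp gp _) => // e.
have := congr1 enum_val e; rewrite /c !enum_rankK_in ?hA ?(valP f) ?(valP g) //.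
by move->.
Qed.

End Metric.

(** * Edge classes *)

Lemma edgesP (G : sgraph) (f : {set G}) :
  reflect (exists x y, adj x y /\ f = [set x; y]) (f \in edges G).
Proof.
apply: (iffP idP) => [|[x [y [xy ->]]]].
  by rewrite inE => /existsP[x /existsP[y /andP[xy /eqP->]]]; exists x, y.
by rewrite inE; apply/existsP; exists x; apply/existsP; exists y; rewrite xy eqxx.
Qed.

Lemma card_edge (G : sgraph) (f : {set G}) : f \in edges G -> #|f| = 2.
Proof. by case/edgesP=> x [y [xy ->]]; rewrite cards2 (adj_neq xy). Qed.

Lemma edge_set2 (G : sgraph) (x y : G) : ([set x; y] \in edges G) = adj x y.
Proof.
apply/idP/idP=> [xy|xy]; last by apply/edgesP; exists x, y.
have := card_edge xy; case/edgesP: xy => u [v [uv e]].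
rewrite cards2; case: eqVneq => // nxy _.
have := set21 x y; have := set22 x y; rewrite {1 2}e.
case/set2P=> ey; case/set2P=> ex; move: nxy uv; rewrite ex ey ?eqxx //.
by rewrite adj_sym.
Qed.

Lemma edge_eq_set2 (G : sgraph) (f : {set G}) x y :
  f \in edges G -> x \in f -> y \in f -> x != y -> f = [set x; y].
Proof.
move=> fE xf yf nxy; apply/eqP; rewrite eq_sym eqEcard (card_edge fE) cards2 nxy.
by rewrite andbT; apply/subsetP=> z /set2P[]->.
Qed.

Definition clique (G : sgraph) (S : {set G}) := {in S &, forall x y, x != y -> adj x y}.

Lemma clique_dist (G : sgraph) (Gc : connected G) (S : {set G}) x y :
  clique S -> x \in S -> y \in S -> dist x y <= 1.
Proof.
move=> cS xS yS; have [->|nxy] := eqVneq x y; first by rewrite distxx.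
by rewrite dist_adj ?cS.
Qed.

Lemma triangle_clique (G : sgraph) (T : {set G}) : triangle T -> clique T.
Proof.
by case/andP=> _ /forall_inP H x y xT yT nxy; move/forall_inP/(_ y yT)/implyP: (H x xT); apply.
Qed.

Lemma card_triangleD1 (G : sgraph) (T : {set G}) x :
  triangle T -> x \in T -> #|T :\ x| = 2.
Proof.
by case/andP=> /eqP T3 _ xT; have := cardsD1 x T; rewrite xT T3 add1n => -[].
Qed.

Lemma edge_clique (G : sgraph) (f : {set G}) : f \in edges G -> clique f.
Proof.
by move=> fE x y xf yf nxy; rewrite -edge_set2 -(edge_eq_set2 fE xf yf nxy).
Qed.

Lemma triangleP (G : sgraph) (T : {set G}) :
  reflect (exists a b c, [/\ adj a b, adj b c, adj a c & T = [set a; b; c]])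
          (triangle T).
Proof.
apply: (iffP idP) => [tT|[a [b [c [ab bc ac ->]]]]].
  have /andP[/eqP T3 _] := tT; have cT := triangle_clique tT.
  have /card_gt0P[a aT] : 0 < #|T| by rewrite T3.
  have /cards2P[b [c [nbc e]]] : #|T :\ a| == 2.
    by move: T3; rewrite (cardsD1 a T) aT; lia.
  have /setD1P[nba bT] : b \in T :\ a by rewrite e set21.
  have /setD1P[nca cT'] : c \in T :\ a by rewrite e set22.
  exists a, b, c; split; try by rewrite cT // eq_sym.
  by rewrite -setUA -e setD1K.
apply/andP; split.
  rewrite -setUA cardsU1 cards2 !inE (negPf (adj_neq ab)) (negPf (adj_neq ac)).
  by rewrite (adj_neq bc).
apply/forall_inP=> x; rewrite !inE -orbA => xT.
apply/forall_inP=> y; rewrite !inE -orbA => yT.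
apply/implyP; case/or3P: xT => /eqP->; case/or3P: yT => /eqP->;
  rewrite ?eqxx // => _; by rewrite // adj_sym.
Qed.

Lemma in_edges_in (G : sgraph) (W f : {set G}) :
  (f \in edges_in W) = (f \in edges G) && (f \subset W).
Proof. by rewrite [LHS]inE. Qed.

Section Classes.
Variables (G : sgraph) (D : {set {set G}}).
Hypothesis (Dtri : edge_disjoint_triangles D).
Implicit Types (x y z : G) (f g S T : {set G}).

(** A class is recorded by its vertex set. By edge-disjointness at most one [T] contains a given
    edge, so [pick] makes no real choice. *)
Definition edge_class f :=
  if [pick T in D | f \subset T] is Some T then T else f.

Variant edge_class_spec f : {set G} -> Type :=
| EdgeClassTriangle T of T \in D & f \subset T : edge_class_spec f T
| EdgeClassEdge of (forall T, T \in D -> ~~ (f \subset T)) : edge_class_spec f f.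

Lemma edge_classP f : edge_class_spec f (edge_class f).
Proof.
rewrite /edge_class; case: pickP => [T /andP[]|H]; first exact: EdgeClassTriangle.
by apply: EdgeClassEdge => T TD; have := H T; rewrite TD /= => ->.
Qed.

Lemma sub_edge_class f : f \subset edge_class f.
Proof. by case: edge_classP. Qed.

Lemma edge_class_clique f : f \in edges G -> clique (edge_class f).
Proof.
by case: edge_classP => [T /Dtri.1/triangle_clique //|_ /edge_clique].
Qed.

Lemma edge_class_triangle f T :
  f \in edges G -> T \in D -> f \subset T -> edge_class f = T.
Proof.
move=> fE TD fT; case: edge_classP => [T' T'D fT'|/(_ T TD)/negP//].
apply/eqP/negPn/negP=> nT; have fI (U : {set G}) : f \subset U -> f \in edges_in U by move=> fU; rewrite in_edges_in fE.
by have := disjointFr (Dtri.2 _ _ T'D TD nT) (fI _ fT'); rewrite fI.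
Qed.

Lemma edge_class_sub f g : f \in edges G -> g \in edges G ->
  g \subset edge_class f -> edge_class g = edge_class f.
Proof.
move=> fE gE; case: (edge_classP f) => [T TD fT gT|N gf].
  exact: edge_class_triangle gE TD gT.
have -> : g = f by apply/eqP; rewrite eqEcard gf !card_edge.
by case: edge_classP => // T /N/negP.
Qed.

Lemma edge_class_set2 f x y : f \in edges G -> adj x y ->
  x \in edge_class f -> y \in edge_class f -> edge_class [set x; y] = edge_class f.
Proof.
move=> fE xy xf yf; apply: edge_class_sub; rewrite ?edge_set2 //.
by apply/subsetP=> z /set2P[]->.
Qed.

(** Two distinct common vertices would span an edge belonging to both classes. *)
Lemma edge_class_meet f g x y : f \in edges G -> g \in edges G ->
  edge_class f != edge_class g -> x \in edge_class f -> x \in edge_class g ->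
  y \in edge_class f -> y \in edge_class g -> x = y.
Proof.
move=> fE gE + xf xg yf yg; apply: contraNeq => nxy.
have xy := edge_class_clique fE xf yf nxy.
by rewrite -(edge_class_set2 fE xy) // (edge_class_set2 gE xy).
Qed.

Definition classes := edge_class @: edges G.

Lemma card_edges_in_clique S : clique S -> #|edges_in S| = 'C(#|S|, 2).
Proof.
move=> cS; rewrite -cards_draws; apply: eq_card => f; rewrite in_edges_in [RHS]inE.
apply/andP/andP=> [[fE fS]|[fS /cards2P[x [y [nxy ef]]]]].
  by rewrite fS card_edge.
split=> //; rewrite ef edge_set2 cS //; apply: (subsetP fS); rewrite ef; [exact: set21|exact: set22].
Qed.

Lemma card_classes : #|edges G| = #|classes| + 2 * #|D|.
Proof.
rewrite -sum1_card (partition_big_imset edge_class) /= -/classes.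
(* The summand is the number of edges of the class [S]: three for a triangle of [D], one
   otherwise. *)
have -> : #|classes| + 2 * #|D| = \sum_(S in classes) (1 + 2 * (S \in D)).
  rewrite big_split /= sum1_card -big_distrr /= -big_mkcondr /= sum1_card.
  congr (_ + 2 * _); apply: eq_card => T.
  apply/idP/andP=> [TD|[]//]; split=> //.
  have /triangleP[a [b [c [ab _ _ eT]]]] := Dtri.1 _ TD.
  apply/imsetP; exists [set a; b]; first by rewrite edge_set2.
  rewrite (@edge_class_triangle _ T) ?edge_set2 //.
  by rewrite eT; apply: subsetUl.
apply: eq_bigr => S /imsetP[f fE ->]; rewrite sum1dep_card.
have -> : [set g in edges G | edge_class g == edge_class f] = edges_in (edge_class f).
  apply/setP=> g; rewrite [LHS]inE in_edges_in; case gE: (g \in edges G) => //=.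
  apply/eqP/idP=> [<-|]; [exact: sub_edge_class|exact: edge_class_sub].
rewrite card_edges_in_clique; last exact: edge_class_clique.
case: edge_classP => [T TD _|N]; first by rewrite TD; case/andP: (Dtri.1 _ TD) => /eqP->.
rewrite card_edge //; case fD: (f \in D) => //.
by have := N _ fD; rewrite subxx.
Qed.

Hypothesis (Gc : connected G).

Lemma crossing_clique S x x' y' y :
  clique S -> crossing x x' y' y -> x \in S -> y \in S -> False.
Proof.
by move=> cS /and3P[_ _ /eqP d] xS yS; have := clique_dist Gc cS xS yS; rewrite d.
Qed.

(** Through [o] the distance from [x] to [y] is at most 2, which forces [x' = y']; being common to
    both classes, this vertex is [o]. *)
Lemma crossing_star f g o x x' y' y : f \in edges G -> g \in edges G ->
  edge_class f != edge_class g -> o \in edge_class f -> o \in edge_class g ->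
  crossing x x' y' y -> x \in edge_class f -> x' \in edge_class f ->
  y' \in edge_class g -> y \in edge_class g -> x' = o /\ y' = o.
Proof.
move=> fE gE nfg of_ og cr xf x'f y'g yg.
have H := edge_class_meet fE gE nfg.
have /and3P[_ _ /eqP d] := cr.
have := clique_dist Gc (edge_class_clique fE) xf of_.
have := clique_dist Gc (edge_class_clique gE) og yg.
have := dist_triangle Gc o x y; rewrite d => d1 d2 d3.
have /eqP : dist x' y' = 0 by move: d1 d2 d3; lia.
rewrite dist_eq0 // => /eqP e; rewrite -{}e in y'g *.
by have := H _ _ x'f y'g of_ og.
Qed.

Lemma same_class_not_crossing x x' y' y :
  crossing x x' y' y -> edge_class [set x; x'] != edge_class [set y'; y].
Proof.
move=> cr; have /and3P[xx' yy' _] := cr; apply/eqP=> e.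
apply: (@crossing_clique (edge_class [set x; x'])) cr _ _.
- by apply: edge_class_clique; rewrite edge_set2.
- by rewrite (subsetP (sub_edge_class _)) // set21.
- by rewrite e (subsetP (sub_edge_class _)) // set22.
Qed.

Lemma src_le : src Gc + 2 * #|D| <= #|edges G|.
Proof.
rewrite card_classes leq_add2r; apply: (@src_le_card _ _ _ edge_class).
  by move=> f fE; apply: imset_f.
move=> u v; apply: rainbow_geodesic => // x x' y' y; exact: same_class_not_crossing.
Qed.

(** * Saving a color by dissolving a class *)

Lemma src_lt S (h : {set G} -> {set G}) : S \in classes ->
  {in edges G, forall f, h f \in classes :\ S} ->
  (forall u v, exists p,
     [/\ geodesic u p, last u p = v & rainbow_label h u p]) ->
  src Gc + 2 * #|D| < #|edges G|.
Proof.
move=> SC hA /(src_le_card Gc hA); rewrite card_classes (cardsD1 S classes) SC.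
by rewrite add1n addSn ltnS leq_add2r.
Qed.

(** Each edge [f] of [S] moves to the class [r f]. Edges of one old class never cross, so a conflict
    pairs an edge of [S] with an old member of its new class; such a pair is rerouted from [a] to
    [b]. *)
Lemma src_lt_dissolve S (r : {set G} -> {set G}) a b : S \in classes -> a != b ->
  {in edges G, forall f, edge_class f = S -> r f \in classes :\ S} ->
  (forall x x' y' y, crossing x x' y' y ->
     edge_class [set x; x'] = S -> edge_class [set y'; y] = r [set x; x'] ->
     [/\ x' = a, y' = a, adj x b & adj b y]) ->
  src Gc + 2 * #|D| < #|edges G|.
Proof.
move=> SC nab rC rX.
pose h f := if edge_class f == S then r f else edge_class f.
apply: (@src_lt S h) => // [f fE|u v].
  rewrite /h; case: eqVneq => [/rC->//|nS].
  by rewrite in_setD1 nS imset_f.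
apply: (@rainbow_geodesic_reroute _ _ _ h a b) => // x x' y' y cr.
have /and3P[xx' yy' _] := cr; rewrite /h.
case: eqVneq => eX; case: eqVneq => eY e.
- by have := same_class_not_crossing cr; rewrite eX eY eqxx.
- exact: rX.
(* Here the edge of [S] comes second, so the crossing is read backwards. *)
- have cr' : crossing y y' x' x by rewrite crossing_sym.
  rewrite [in RHS]setUC in e; rewrite setUC in eY.
  have [] := rX _ _ _ _ cr' eY; first by rewrite setUC.
  by move=> -> -> ya ax; rewrite adj_sym [adj b y]adj_sym.
- by have := same_class_not_crossing cr; rewrite e eqxx.
Qed.

Lemma in_classes x y : adj x y -> edge_class [set x; y] \in classes.
Proof. by move=> xy; rewrite imset_f ?edge_set2. Qed.

Lemma mem_class1 x y : x \in edge_class [set x; y].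
Proof. by rewrite (subsetP (sub_edge_class _)) // set21. Qed.

Lemma mem_class2 x y : y \in edge_class [set x; y].
Proof. by rewrite (subsetP (sub_edge_class _)) // set22. Qed.

(* Dissolve the class of [aq]: its edges at [q] join the class of [ab], the
   remaining one that of [bq]. *)
Lemma src_lt_triangle_notin T :
  triangle T -> T \notin D -> src Gc + 2 * #|D| < #|edges G|.
Proof.
move=> /triangleP[a [b [q [ab bq aq eT]]]] TD.
(* A class containing two sides of [T] would contain its three vertices, hence be a triangle of [D]
   equal to [T]. *)
have nclass x y z S : [set x; y; z] = T -> adj x y -> adj y z -> adj x z ->
    edge_class [set x; y] = edge_class [set y; z] -> False.
  move=> exyz xy yz xz e; have z_in := mem_class2 y z; rewrite -e in z_in.
  have x_in := mem_class1 x y; have y_in := mem_class2 x y.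
  move: e x_in y_in z_in; case: edge_classP => [U UD _ _ xU yU zU|_ _ _ _].
    move/negP: TD; apply; suff <- : U = T by [].
    apply/eqP; rewrite eq_sym eqEcard -{1}exyz.
    have /andP[/eqP-> _] := Dtri.1 _ UD.
    have /andP[/eqP-> _] : triangle T by apply/triangleP; exists a, b, q.
    by rewrite andbT; apply/subsetP=> w; rewrite !inE -orbA => /or3P[]/eqP->.
  by rewrite !inE => /orP[]/eqP ez; [move: xz|move: yz]; rewrite ez adj_irrefl.
have qa : adj q a by rewrite adj_sym.
have ba : adj b a by rewrite adj_sym.
have nab_aq : edge_class [set a; b] != edge_class [set a; q].
  apply/eqP; rewrite setUC; apply: (nclass b a q) => //.
  by rewrite eT [[set b; a]]setUC.
have nbq_aq : edge_class [set b; q] != edge_class [set a; q].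
  apply/eqP; rewrite [[set a; q]]setUC; apply: (nclass b q a) => //.
  by rewrite eT setUC setUA.
pose r (f : {set G}) :=
  if q \in f then edge_class [set a; b] else edge_class [set b; q].
apply: (@src_lt_dissolve (edge_class [set a; q]) r a b); rewrite ?in_classes //.
- exact: adj_neq.
- by move=> f fE _; rewrite /r; case: ifP => _; rewrite in_setD1 in_classes ?andbT.
move=> x x' y' y cr eX; have /and3P[xx' yy' /eqP dxy] := cr.
have xS := mem_class1 x x'; have x'S := mem_class2 x x'.
have yg := mem_class2 y' y; have y'g := mem_class1 y' y.
have fE : [set x; x'] \in edges G by rewrite edge_set2.
have gE : [set y'; y] \in edges G by rewrite edge_set2.
rewrite /r; case: ifP => qf eY.
  (* The classes of [aq] and [ab] share [a], so the crossing starts at [q] and turns at [a]. The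
     vertex [y] lies in the class of [ab] and is not [b], which is adjacent to [q]; so the detour
     through [b] exists. *)
  have [|||ex' ey'] := crossing_star fE gE _ _ _ cr xS x'S y'g yg (o := a).
  - by rewrite eX eY eq_sym.
  - by rewrite eX mem_class1.
  - by rewrite eY mem_class1.
  subst x' y'; move: qf; rewrite !inE => /orP[/eqP eq|/eqP eq]; last first.
    by rewrite eq adj_irrefl in aq.
  subst x; split=> //; first by rewrite adj_sym.
  rewrite (edge_class_clique gE) ?eY ?mem_class2 //; first by rewrite -eY.
  by apply/eqP=> eb; move: dxy; rewrite -eb distxx // dist_adj // adj_sym.
(* These two classes share [q], so the crossing would turn at [q], which is not on the edge. *)
have [] := crossing_star fE gE _ _ _ cr xS x'S y'g yg (o := q).
- by rewrite eX eY eq_sym.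
- by rewrite eX mem_class2.
- by rewrite eY mem_class2.
by move=> ex'; move: qf; rewrite ex' set22.
Qed.

(** The class of an edge leaving [T] at [o] meets [T] only in [o], so a crossing with it would turn
    at [o]. The edge of [T] that joins this class is opposite to [o], so no conflict arises. *)
Lemma src_lt_triangle_degree T : T \in D ->
  {in T, forall x, exists2 z, adj x z & z \notin T} ->
  src Gc + 2 * #|D| < #|edges G|.
Proof.
move=> TD out.
have /triangleP[a [b [c [ab bc ac eT]]]] := Dtri.1 _ TD.
have opp f : f \in edges G -> edge_class f = T -> exists2 o, o \in T & o \notin f.
  move=> fE fT; have /subsetPn[o] : ~~ (T \subset f); last by exists o.
  apply/negP=> /subset_leq_card; rewrite (card_edge fE).
  by have /andP[/eqP-> _] := Dtri.1 _ TD.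
pose n x := odflt x [pick z | adj x z && (z \notin T)].
have nP x : x \in T -> adj x (n x) /\ n x \notin T.
  move=> /out[z xz zT]; rewrite /n; case: pickP => [w /andP[]//|/(_ z)].
  by rewrite xz zT.
pose o (f : {set G}) := odflt a [pick x in T :\: f].
have oP f : f \in edges G -> edge_class f = T -> o f \in T /\ o f \notin f.
  move=> fE /opp-/(_ fE)[x xT xf]; rewrite /o; case: pickP => [z|/(_ x)].
    by rewrite inE => /andP[].
  by rewrite inE xT xf.
have nC x : x \in T -> edge_class [set x; n x] != T.
  by move=> /nP[_ nT]; apply: contraNneq nT => <-; exact: mem_class2.
apply: (@src_lt_dissolve T (fun f => edge_class [set o f; n (o f)]) a b).
- have <- : edge_class [set a; b] = T; last exact: in_classes.
  by apply: edge_class_triangle; rewrite ?edge_set2 // eT subsetUl.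
- exact: adj_neq.
- move=> f fE fT; have [oT _] := oP f fE fT.
  by rewrite in_setD1 nC // in_classes //; case: (nP _ oT).
move=> x x' y' y cr eX eY; have /and3P[xx' yy' _] := cr.
have fE : [set x; x'] \in edges G by rewrite edge_set2.
have gE : [set y'; y] \in edges G by rewrite edge_set2.
have [oT of_] := oP _ fE eX.
have [] := crossing_star fE gE _ _ _ cr (mem_class1 _ _) (mem_class2 _ _)
  (mem_class1 _ _) (mem_class2 _ _) (o := o [set x; x']).
- by rewrite eX eY eq_sym nC.
- by rewrite eX.
- by rewrite eY mem_class1.
by move=> ex'; move: of_; rewrite -ex' set22.
Qed.

End Classes.

(** * Cycles *)

Section Cycle.
Variables (G : sgraph) (D : {set {set G}}).
Hypothesis (Dtri : edge_disjoint_triangles D).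
Hypothesis (Gc : connected G).
Implicit Types (x y z : G) (f g S T : {set G}).
Local Notation cls := (edge_class D).

Hypothesis (Ddeg : forall T, T \in D -> exists2 x, x \in T & degree x = 2).

Lemma triangle_third T a b y : triangle T -> a \in T -> b \in T -> y \in T ->
  a != b -> y != a -> y != b -> T = [set a; b; y].
Proof.
case/andP=> /eqP T3 _ aT bT yT nab nya nyb; apply/eqP.
have -> : [set a; b; y] = y |: [set a; b] by rewrite setUC.
rewrite eq_sym eqEcard T3 cardsU1 cards2 !inE negb_or nab nya nyb /= andbT; apply/subsetP=> z.
by rewrite !inE => /or3P[]/eqP->.
Qed.

Lemma degree2_triangle T x z :
  triangle T -> x \in T -> degree x = 2 -> adj x z -> z \in T.
Proof.
move=> tT xT d2 xz.
suff /eqP eT : T :\ x == [set y | adj x y].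
  by have : z \in T :\ x; [rewrite eT inE | case/setD1P].
rewrite eqEcard -/(degree x) d2 card_triangleD1 // andbT; apply/subsetP=> y /setD1P[nyx yT].
by rewrite inE (triangle_clique tT) // eq_sym.
Qed.

(* If the class of [ab] is a triangle then its third vertex has degree 2. *)
Definition pendant a b := forall y z,
  y \in cls [set a; b] -> y != a -> y != b -> adj y z -> z = a \/ z = b.

(** The edges [ap] and [bq] leave the class, so in a triangle class neither [a] nor [b] has degree
    two; the third vertex does. *)
Lemma pendantP a b p q : adj a b ->
  adj a p -> cls [set a; p] != cls [set a; b] ->
  adj b q -> cls [set b; q] != cls [set a; b] -> pendant a b.
Proof.
move=> ab ap + bq + y z; have abE : [set a; b] \in edges G by rewrite edge_set2.
have a_in := mem_class1 D a b; have b_in := mem_class2 D a b.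
have p_in := edge_class_set2 Dtri abE ap a_in.
have q_in := edge_class_set2 Dtri abE bq b_in.
have /orP := orbN (p \in cls [set a; b]); case=> [/p_in->|np _]; first by rewrite eqxx.
have /orP := orbN (q \in cls [set a; b]); case=> [/q_in->|nq _]; first by rewrite eqxx.
move: a_in b_in np nq; case: edge_classP => [T TD _|_] aT bT np nq yT nya nyb yz; last first.
  by move: yT; rewrite !inE (negPf nya) (negPf nyb).
have tT := Dtri.1 _ TD; have eT := triangle_third tT aT bT yT (adj_neq ab) nya nyb.
have [x xT dx] := Ddeg TD.
have nbr := degree2_triangle tT xT dx.
have ex : x = y.
  move: xT; rewrite {1}eT !inE -orbA => /or3P[]/eqP ex //; move: nbr; rewrite ex.
    by move/(_ p ap); rewrite (negPf np).
  by move/(_ q bq); rewrite (negPf nq).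
subst x; have := nbr z yz; rewrite eT !inE -orbA => /or3P[]/eqP ez; auto.
by rewrite ez adj_irrefl in yz.
Qed.

(** The alternative is a geodesic going from [a] to the third vertex of a triangle class. Its next
    vertex would again be in the class, within distance 1 of [a]. *)
Lemma pendant_crossing a b x x' y' y : adj a b -> pendant a b ->
  crossing x x' y' y -> a \in [set x; x'] -> cls [set x; x'] = cls [set a; b] ->
  cls [set y'; y] != cls [set a; b] -> x' = a \/ x' = b.
Proof.
move=> ab pend cr ax ex ney; have /and3P[xx' yy' /eqP dxy] := cr.
have [->|nx'a] := eqVneq x' a; first by left.
have [->|nx'b] := eqVneq x' b; first by right.
have x'_in : x' \in cls [set a; b] by rewrite -ex mem_class2.
have nbr z := pend x' z x'_in nx'a nx'b.
have exa : x = a by move: ax; rewrite !inE (eq_sym a x') (negPf nx'a) orbF => /eqP.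
subst x.
have abE : [set a; b] \in edges G by rewrite edge_set2.
have z_in z : adj x' z -> z \in cls [set a; b].
  by case/nbr=> ->; [exact: mem_class1|exact: mem_class2].
have [e|nx'y'] := eqVneq x' y'.
  subst y'; move/negP: ney; case; apply/eqP.
  have H := edge_class_set2 Dtri abE yy' x'_in (z_in y yy'). by rewrite H.
have [z x'z dz] := dist_first_step Gc nx'y'.
have := clique_dist Gc (edge_class_clique Dtri abE) (mem_class1 D a b) (z_in z x'z).
have := dist_triangle Gc z a y'; have := dist_triangle Gc y' a y.
by rewrite (dist_adj Gc yy') dxy dz; lia.
Qed.

(* The two alternatives are antipodal edges [ab] and [vw] of an isometric cycle
   with [2k + 2], respectively [2k + 3], vertices. *)
Lemma src_lt_antipodal a b v w p q k :
  adj a b -> adj v w -> adj a p -> adj v q ->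
  uniq [:: cls [set a; b]; cls [set v; w]; cls [set a; p]; cls [set v; q]] ->
  pendant a b -> pendant v w ->
  [/\ dist a v = k.+1, dist a w = k, dist b v = k & dist b w = k.+1] \/
  [/\ dist a v = k.+1, dist a w = k.+1, dist b v = k.+1 & dist b w = k] ->
  src Gc + 2 * #|D| < #|edges G|.
Proof.
move=> ab vw ap vq + pE pF dk.
set E := cls [set a; b]; set F := cls [set v; w].
set P := cls [set a; p]; set Q := cls [set v; q].
rewrite /= !inE !negb_or -!andbA => /and5P[nEF nEP nEQ nFP /and3P[nFQ nPQ _]].
have [abE vwE] : [set a; b] \in edges G /\ [set v; w] \in edges G by rewrite !edge_set2.
have [apE vqE] : [set a; p] \in edges G /\ [set v; q] \in edges G by rewrite !edge_set2.
(* The label [F] disappears: edges of [F] at [v] take [E], any other edge of [F] takes [Q]. An edge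
   of [E] not at [a] makes room by taking [P]. *)
pose h g := if cls g == F then if v \in g then E else Q
            else if (cls g == E) && (a \notin g) then P else cls g.
(* Old and new holders of the label [E] never cross: the inner ends are among [a], [b] and [v], [w],
   and the distances in [dk] exclude each case. *)
have main x x' y' y : crossing x x' y' y -> cls [set x; x'] = E ->
    cls [set y'; y] = F -> a \in [set x; x'] -> v \in [set y'; y] -> False.
  move=> cr fE gF ax vy; have /and3P[xx' yy' /eqP dxy] := cr.
  have x'ab : x' = a \/ x' = b.
    by apply: pendant_crossing cr ax _ _ => //; rewrite -/E gF eq_sym.
  have y'vw : y' = v \/ y' = w.
    have cr' : crossing y y' x' x by rewrite crossing_sym.
    have e : [set y; y'] = [set y'; y] by rewrite setUC.
    apply: pendant_crossing cr' _ _ _ => //; rewrite ?e //.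
    by rewrite setUC fE.
  have x_in : x \in E by rewrite -fE mem_class1.
  have y_in : y \in F by rewrite -gF mem_class2.
  have c1 := clique_dist Gc (edge_class_clique Dtri abE).
  have c2 := clique_dist Gc (edge_class_clique Dtri vwE).
  have xb := c1 _ _ x_in (mem_class2 D a b).
  have xa := c1 _ _ x_in (mem_class1 D a b).
  have vy1 := c2 _ _ (mem_class1 D v w) y_in.
  have wy1 := c2 _ _ (mem_class2 D v w) y_in.
  have t1 z z' : dist x y <= dist x z + dist z z' + dist z' y.
    by apply: leq_trans (dist_triangle Gc z' x y) _; rewrite leq_add2r dist_triangle.
  have taw := t1 a w; have tbv := t1 b v; have tbw := t1 b w; have tav := t1 a v.
  have ex : x = a /\ x' = b \/ x' = a.
    by move: ax; rewrite !inE => /orP[]/eqP; case: x'ab; auto => -> e;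
       move: xx'; rewrite e adj_irrefl.
  have ey : y = v /\ y' = w \/ y' = v.
    by move: vy; rewrite !inE => /orP[]/eqP; case: y'vw; auto => -> e;
       move: yy'; rewrite e adj_irrefl.
  have d0 := @distxx G.
  case: ex => [[ex ex']|ex']; case: ey => [[ey ey']|ey']; subst;
    rewrite ?d0 in taw tbv tbw tav xa xb vy1 wy1 *; case: dk => -[] + + + +;
    move: taw tbv tbw tav xa xb vy1 wy1 dxy; clear; lia.
have label_E x x' y' y : crossing x x' y' y -> cls [set x; x'] = E ->
    h [set x; x'] = h [set y'; y] -> False.
  move=> cr fE; have /and3P[xx' yy' _] := cr.
  have nfg := same_class_not_crossing Dtri Gc cr; rewrite fE in nfg.
  have [fin gin] : [set x; x'] \in edges G /\ [set y'; y] \in edges G.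
    by rewrite !edge_set2.
  rewrite /h fE (negPf nEF) eqxx /= [cls [set y'; y] == E]eq_sym (negPf nfg) /=.
  case: eqVneq => gF.
    case: ifPn => ax; case: ifPn => vy e.
    - by rewrite e eqxx in nEP.
    - by rewrite e eqxx in nPQ.
    - by apply: main cr fE gF _ vy; rewrite -[_ \in _]negbK.
    - by rewrite e eqxx in nEQ.
  case: ifPn => ax e; last by rewrite e eqxx in nfg.
  (* The classes [E] and [P] share [a], so the crossing would turn there, but the relabelled edge
     avoids [a]. *)
  have [] := crossing_star Dtri Gc fin gin _ _ _ cr (mem_class1 _ _ _)
    (mem_class2 _ _ _) (mem_class1 _ _ _) (mem_class2 _ _ _) (o := a).
  - by rewrite fE.
  - by rewrite fE mem_class1.
  - by rewrite -e mem_class1.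
  by move=> ex'; move: ax; rewrite ex' set22.
have label_F x x' y' y : crossing x x' y' y -> cls [set x; x'] = F ->
    h [set x; x'] = h [set y'; y] -> False.
  move=> cr fF; have /and3P[xx' yy' _] := cr.
  have nfg := same_class_not_crossing Dtri Gc cr; rewrite fF in nfg.
  have [fin gin] : [set x; x'] \in edges G /\ [set y'; y] \in edges G.
    by rewrite !edge_set2.
  have [gE|ngE] := eqVneq (cls [set y'; y]) E.
    move=> e; rewrite (crossing_sym Gc) in cr.
    by apply: (label_E _ _ _ _ cr); rewrite setUC ?gE // [in RHS]setUC.
  rewrite /h fF eqxx [cls [set y'; y] == F]eq_sym (negPf nfg) (negPf ngE) /=.
  case: ifPn => vx e; first by rewrite e eqxx in ngE.
  have [] := crossing_star Dtri Gc fin gin _ _ _ cr (mem_class1 _ _ _)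
    (mem_class2 _ _ _) (mem_class1 _ _ _) (mem_class2 _ _ _) (o := v).
  - by rewrite fF.
  - by rewrite fF mem_class1.
  - by rewrite -e mem_class1.
  by move=> ex'; move: vx; rewrite ex' set22.
apply: (@src_lt _ _ Dtri Gc F h); first exact: in_classes.
  move=> f fE; rewrite /h in_setD1.
  have inC g : g \in edges G -> cls g \in classes D by move=> gE; apply: imset_f.
  case: (eqVneq (cls f) F) => [_|nF].
    by case: ifP => _; rewrite ?nEF ?[Q == F]eq_sym ?nFQ inC.
  by case: ifP => _; rewrite ?nF ?[P == F]eq_sym ?nFP inC.
move=> x0 y0; apply: rainbow_geodesic => // x x' y' y cr.
apply/eqP=> e; have same := same_class_not_crossing Dtri Gc cr.
have cr' : crossing y y' x' x by rewrite crossing_sym.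
have e' : h [set y; y'] = h [set x'; x] by rewrite setUC -e setUC.
have sC : [set y; y'] = [set y'; y] by rewrite setUC.
case: (eqVneq (cls [set x; x']) E) => [/(label_E _ _ _ _ cr)/(_ e)//|nE1].
case: (eqVneq (cls [set x; x']) F) => [/(label_F _ _ _ _ cr)/(_ e)//|nF1].
case: (eqVneq (cls [set y; y']) E) => [/(label_E _ _ _ _ cr')/(_ e')//|].
case: (eqVneq (cls [set y; y']) F) => [/(label_F _ _ _ _ cr')/(_ e')//|].
rewrite sC => nF2 nE2; move: e; rewrite /h (negPf nE1) (negPf nE2) (negPf nF1) (negPf nF2) /=.
by move/eqP; rewrite (negPf same).
Qed.

End Cycle.

(** * Shortest cycles that meet a class in one edge *)

Section ShortestCycle.
Variables (G : sgraph) (D : {set {set G}}).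
Hypothesis (Dtri : edge_disjoint_triangles D).
Hypothesis (Gc : connected G).
Hypothesis (all_in_D : forall T, triangle T -> T \in D).
Hypothesis (Ddeg : forall T, T \in D -> exists2 x, x \in T & degree x = 2).
Implicit Types (x y z : G) (S T : {set G}) (p : seq G).
Local Notation cls := (edge_class D).

Definition avoid S : rel G := [rel x y | adj x y && (cls [set x; y] != S)].

Lemma avoid_sym S : symmetric (avoid S).
Proof. by move=> x y; rewrite /avoid /= adj_sym setUC. Qed.

Definition walk S x y k :=
  exists p, [/\ path (avoid S) x p, last x p = y & size p = k].

Lemma walk0 S x : walk S x x 0.
Proof. by exists [::]. Qed.

Lemma walk1 S x y : avoid S x y -> walk S x y 1.
Proof. by exists [:: y]; split=> //=; rewrite andbT. Qed.

Lemma walk_trans S y x z k l : walk S x y k -> walk S y z l -> walk S x z (k + l).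
Proof.
move=> [p [pP py <-]] [q [qP qz <-]]; exists (p ++ q).
by rewrite cat_path pP py last_cat py size_cat.
Qed.

Lemma walk_rev S x y k : walk S x y k -> walk S y x k.
Proof.
case=> p; elim: p x k => [|z p IH] x k [/=].
  by move=> _ -> <-; exact: walk0.
case/andP=> xz pP py <-; rewrite -addn1; apply: (@walk_trans _ z).
  exact: IH.
by apply: walk1; rewrite avoid_sym.
Qed.

Lemma walk_dist S x y k : walk S x y k -> dist x y <= k.
Proof.
case=> p [pP <- <-]; apply: dist_le_size.
by apply: sub_path pP => u v /andP[].
Qed.

Variables (a b : G) (p : seq G).
Hypotheses (ab : adj a b) (pP : path (avoid (cls [set a; b])) a p)
  (pb : last a p = b)
  (pmin : forall x y k, adj x y -> walk (cls [set x; y]) x y k -> size p <= k).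

(** The cycle runs through [u 0 = a], ..., [u N = b] and closes with [ab], so its length is
    [N.+1]. *)
Local Notation N := (size p).
Local Notation u i := (nth a (a :: p) i).
Local Notation C i := (cls [set u i; u i.+1]).
Local Notation E := (cls [set a; b]).

Let uN : u N = b.
Proof. by rewrite -pb (last_nth a). Qed.

Let step i : i < N -> adj (u i) (u i.+1) /\ C i != E.
Proof. by move=> iN; move/pathP: pP => /(_ a i iN)/andP[]. Qed.

Let subwalk S i j : i <= j <= N -> (forall l, i <= l < j -> C l != S) ->
  walk S (u i) (u j) (j - i).
Proof.
case/andP; elim: j => [|j IH]; first by case: i => // _ _ _; exact: walk0.
rewrite leq_eqVlt => /predU1P[-> _ _|ij jN CS]; first by rewrite subnn; exact: walk0.
rewrite subSn // -[(j - i).+1]addn1; apply: (@walk_trans _ (u j)).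
  apply: IH => // [|l /andP[il lj]]; first exact: ltnW.
  by apply: CS; rewrite il ltnW.
apply: walk1; rewrite /avoid /= CS ?leqnn ?andbT //.
by case: (step jN).
Qed.

Let edge_u i : i < N -> [set u i; u i.+1] \in edges G.
Proof. by move=> iN; rewrite edge_set2; case: (step iN). Qed.

(** If the edges [i < j] shared a class, [u i] and [u j.+1] would be equal or joined by an edge of
    that class, which is not [E]: a shortcut against minimality. *)
Let C_inj i j : i < j < N -> C i != C j.
Proof.
case/andP=> ij jN; have iN : i < N := ltn_trans ij jN.
have CE l : l < N -> C l != E by case/step.
apply/eqP=> e.
have xC := mem_class1 D (u i) (u i.+1).
have yC := mem_class2 D (u j) (u j.+1); rewrite -e in yC.
have w1 : walk E (u 0) (u i) (i - 0).
  apply: subwalk => [|l /andP[_ li]]; first by rewrite leq0n ltnW.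
  exact: CE (ltn_trans li iN).
have w2 : walk E (u j.+1) (u N) (N - j.+1).
  by apply: subwalk => [|l /andP[_ lN]]; [rewrite jN leqnn|apply: CE].
rewrite uN in w2.
have [exy|nxy] := eqVneq (u i) (u j.+1).
  rewrite -exy in w2; have /= := pmin ab (walk_trans w1 w2).
  by move: ij jN; clear; lia.
have xy := edge_class_clique Dtri (edge_u iN) xC yC nxy.
have w : walk E (u i) (u j.+1) 1.
  apply: walk1; rewrite /avoid /= xy.
  by rewrite (edge_class_set2 Dtri (edge_u iN) xy xC yC) CE.
have /= := pmin ab (walk_trans w1 (walk_trans w w2)).
by move: ij jN; clear; lia.
Qed.

(** For [N = 2] the cycle is a triangle, hence in [D], and its edges form one class. *)
Let N_ge3 : 2 < N.
Proof.
move: (step) uN; case: p => [|u1 [|u2 [|u3 q]]] //= st ub.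
- by move: ab; rewrite ub adj_irrefl.
- by have [_] := st 0 isT; rewrite /= ub eqxx.
have [/= a1 C0] := st 0 isT; have [/= b1 _] := st 1 isT.
rewrite ub in b1 *.
have tT : triangle [set a; u1; b] by apply/triangleP; exists a, u1, b.
move: C0; rewrite !(edge_class_triangle Dtri _ (all_in_D tT)) ?edge_set2 ?eqxx //.
  by apply/subsetP=> z; rewrite !inE => /orP[]->; rewrite ?orbT.
exact: subsetUl.
Qed.

(* A shorter connection between [u i] and [u j] misses the class of some edge
   of the path between them, and so closes a shorter cycle. *)
Let u_isometric i j : i <= j <= N ->
  dist (u i) (u j) = minn (j - i) (N.+1 - (j - i)).
Proof.
case/andP=> ij jN; apply/eqP; rewrite eqn_leq; apply/andP; split.
  have up l m : l <= m <= N -> dist (u l) (u m) <= m - l.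
    move=> lm; apply: (@walk_dist E); apply: subwalk => // r /andP[_ rm].
    by have [] // := @step r; move: lm rm; clear; lia.
  rewrite leq_min up ?ij //=.
  (* The other way round the cycle passes through [ab]. *)
  have := up 0 i; have := up j N; rewrite jN leqnn uN => /(_ isT) h1.
  rewrite (leq_trans ij jN) => /(_ isT) h2.
  have := dist_triangle Gc a (u i) (u j); have := dist_triangle Gc b a (u j).
  rewrite (dist_adj Gc ab) (distC Gc b) (distC Gc (u i) a).
  by move: h1 h2 ij jN => /=; clear; lia.
rewrite leqNgt; apply/negP; rewrite leq_min => /andP[lt1 lt2].
have [q [qP quj sq]] := dist_geodesic Gc (u i) (u j).
pose A := [seq cls f | f <- path_edges (u i) q].
have sA : size A = size q by rewrite size_map size_pairmap.
(* Pigeonhole: the [j - i] classes between [u i] and [u j] are distinct, and [q] has fewer edges. *)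
have [l /andP[il lj] lA] : exists2 l, i <= l < j & C l \notin A.
  have Cu : uniq [seq C l | l <- iota i (j - i)].
    rewrite map_inj_in_uniq ?iota_uniq // => l m; rewrite !mem_iota subnKC //.
    case/andP=> il lj /andP[im mj] e.
    have [lm|ml|//] := ltngtP l m.
      have := @C_inj l m; rewrite e eqxx; move: lm mj jN; clear; lia.
    have := @C_inj m l; rewrite e eqxx; move: ml lj jN; clear; lia.
  have : ~~ all (mem A) [seq C l | l <- iota i (j - i)].
    apply/negP=> /allP/(uniq_leq_size Cu).
    by rewrite size_map size_iota sA sq leqNgt lt1.
  case/allPn=> c /mapP[l]; rewrite mem_iota subnKC // => lij -> lA.
  by exists l.
have lN : l < N := leq_trans lj jN.
have wq : walk (C l) (u i) (u j) (size q).
  exists q; split=> //; apply/(pathP (u i)) => r rq.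
  move/(pathP (u i)): (qP) => /(_ r rq) rr; rewrite /avoid /= rr /=.
  apply: contraNneq lA => <-; apply: map_f; apply/path_edgesP.
  by exists r.
have w1 : walk (C l) (u i) (u l) (l - i).
  apply: subwalk => [|r /andP[_ rl]]; first by rewrite il ltnW.
  by apply: C_inj; rewrite rl.
have w2 : walk (C l) (u l.+1) (u j) (j - l.+1).
  apply: subwalk => [|r /andP[lr rj]]; first by rewrite lj.
  by rewrite eq_sym; apply: C_inj; rewrite lr (leq_trans rj).
have [ul _] := step lN.
(* From [u l] back to [u i], along [q], and from [u j] back to [u l.+1]: this walk has length
   [size q + (j - i) - 1], less than [N]. *)
have := pmin ul (walk_trans (walk_rev w1) (walk_trans wq (walk_rev w2))).
by move: lt1 lt2 il lj jN; rewrite sq; clear; lia.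
Qed.

Let pendant_u i : 0 < i -> i.+1 < N -> pendant D (u i) (u i.+1).
Proof.
case: i => // i _ iN.
have [h1 _] := step (ltnW (ltnW iN)); have [h2 _] := step (ltnW iN).
have [h3 _] := step iN.
apply: (pendantP Dtri Ddeg h2 (p := u i) (q := u i.+3)) => //.
- by rewrite adj_sym.
- by rewrite setUC C_inj // ltnSn ltnW.
- by rewrite eq_sym C_inj // ltnSn iN.
Qed.

Lemma src_lt_shortest_cycle : src Gc + 2 * #|D| < #|edges G|.
Proof.
have N3 := N_ge3.
have pE : pendant D a b.
  have [h1 n1] := @step 0 (ltnW (ltnW N3)).
  have N1 : N.-1 < N by move: N3; clear; lia.
  have [h2 n2] := step N1.
  have eN : N.-1.+1 = N by move: N3; clear; lia.
  rewrite eN uN in h2 n2.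
  apply: (pendantP Dtri Ddeg ab h1 n1 (q := u N.-1)); first by rewrite adj_sym.
  by rewrite setUC.
have [h0 n0] := @step 0 (ltnW (ltnW N3)).
(* The cases are cycles of even and odd length. Positivity of [k] keeps [C 0], [C k] and [C k.+1]
   distinct. *)
have [k k0 eN] : exists2 k, 0 < k & (N == k.*2.+1) || (N == k.*2.+2).
  by exists N.-1./2; move: N3; clear; lia.
have da i : i <= N -> dist a (u i) = minn i (N.+1 - i).
  by move=> iN; rewrite (@u_isometric 0 i) ?subn0 // leq0n.
have db i : i <= N -> dist b (u i) = minn (N - i) (N.+1 - (N - i)).
  by move=> iN; rewrite distC // -uN u_isometric // iN leqnn.
have k1N : k.+1 < N by move: k0 eN N3; clear; lia.
have N0 : 0 < N := ltn_trans (ltn0Sn k) k1N.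
have kN := ltnW k1N; have [hk nk] := step kN; have [hk1 nk1] := step k1N.
have nE i : i < N -> E != C i by move=> iN; rewrite eq_sym; case: (step iN).
have uq c1 c2 c3 : E != c1 -> E != c2 -> E != c3 ->
    c1 != c2 -> c1 != c3 -> c2 != c3 -> uniq [:: E; c1; c2; c3].
  by rewrite /= !inE !negb_or => -> -> -> -> -> ->.
case/orP: eN => /eqP eN.
(* The edge antipodal to [ab] joins [v = u k.+1] to [u k] in the even case and to [u k.+2] in the
   odd case; [q] is the other neighbour of [v] on the cycle. *)
- apply: (@src_lt_antipodal _ _ Dtri Gc a b (u k.+1) (u k) (u 1) (u k.+2) k) => //.
  + by rewrite adj_sym.
  + rewrite [[set u k.+1; u k]]setUC -[[set a; u 1]]/[set u 0; u 1].
    apply: uq; rewrite ?nE //.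
    * by rewrite eq_sym C_inj ?k0.
    * by rewrite C_inj ?ltnSn.
    * by rewrite C_inj.
  + move=> y z; rewrite setUC => yC y1 y2 /(pendant_u k0 k1N yC y2 y1)[]; auto.
  + by left; split; rewrite ?da ?db; move: k0 eN; clear; lia.
- apply: (@src_lt_antipodal _ _ Dtri Gc a b (u k.+1) (u k.+2) (u 1) (u k) k) => //.
  + by rewrite adj_sym.
  + rewrite [[set u k.+1; u k]]setUC -[[set a; u 1]]/[set u 0; u 1].
    apply: uq; rewrite ?nE //.
    * by rewrite eq_sym C_inj.
    * by rewrite eq_sym C_inj ?ltnSn.
    * by rewrite C_inj ?k0.
  + by apply: pendant_u => //; move: k0 eN; clear; lia.
  + by right; split; rewrite ?da ?db; move: k0 eN; clear; lia.
Qed.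
End ShortestCycle.

(** * Geodesics through chosen edges *)

Section Separation.
Variables (G : sgraph) (D : {set {set G}}).
Hypothesis (Dtri : edge_disjoint_triangles D).
Hypothesis (Gc : connected G).
Implicit Types (x y z u v w : G) (f g S T : {set G}) (p : seq G) (H : pregraph G).
Local Notation cls := (edge_class D).
Local Notation avoid := (avoid D).

(** No cycle meets a class in exactly one edge. *)
Definition classes_separate :=
  forall a b, adj a b -> ~~ connect (avoid (cls [set a; b])) a b.

(** The minimum is taken over all edges and all walks joining their ends outside their class, as
    [src_lt_shortest_cycle] requires. *)
Lemma src_lt_not_separate :
  (forall T, triangle T -> T \in D) ->
  (forall T, T \in D -> exists2 x, x \in T & degree x = 2) ->
  classes_separate \/ src Gc + 2 * #|D| < #|edges G|.
Proof.
move=> all_in_D Ddeg.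
case: (boolP [forall a, forall b, adj a b ==>
                ~~ connect (avoid (cls [set a; b])) a b]).
  move=> /forallP sep; left=> a b ab.
  by have /forallP/(_ b)/implyP := sep a; apply.
case/forallPn=> a0 /forallPn[b0]; rewrite negb_imply negbK => /andP[ab0 cab].
pose P n := [exists a, exists b, adj a b && [exists p : n.-tuple G,
   path (avoid (cls [set a; b])) a p && (last a p == b)]].
have exP a b n : adj a b -> walk D (cls [set a; b]) a b n -> P n.
  move=> ab [p [pP pb /eqP sp]]; apply/existsP; exists a; apply/existsP; exists b.
  by rewrite ab; apply/existsP; exists (Tuple sp); rewrite pP pb eqxx.
have exn : exists n, P n.
  case/connectP: cab => p pP ep; exists (size p); apply: exP ab0 _.
  by exists p.
case: (ex_minnP exn) => n /existsP[a /existsP[b /andP[ab /existsP[p]]]].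
case/andP=> pP /eqP pb nmin; right.
apply: (src_lt_shortest_cycle Dtri Gc all_in_D Ddeg ab pP pb) => x y k xy wk.
by rewrite size_tuple; apply: nmin; apply: exP wk.
Qed.

Lemma avoidE S x y : avoid S x y = adj x y && (cls [set x; y] != S).
Proof. by []. Qed.

Lemma avoid_in_class f x y : f \in edges G -> x \in cls f -> y \in cls f ->
  avoid (cls f) x y = false.
Proof.
move=> fE xf yf; apply/negP=> /andP[xy].
by rewrite (edge_class_set2 Dtri fE xy) ?eqxx.
Qed.

Lemma not_avoid f x y : adj x y -> ~~ avoid (cls f) x y ->
  x \in cls f /\ y \in cls f.
Proof.
by move=> xy; rewrite avoidE xy negbK => /eqP <-; rewrite mem_class1 mem_class2.
Qed.

Lemma connect_avoid_sym S : connect_sym (avoid S).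
Proof. exact: sym_connect_sym (@avoid_sym _ _ S). Qed.

Lemma connect_avoid_class f x y : classes_separate -> f \in edges G ->
  x \in cls f -> y \in cls f -> connect (avoid (cls f)) x y -> x = y.
Proof.
move=> sep fE xf yf; apply: contraTeq => nxy.
have xy := edge_class_clique Dtri fE xf yf nxy.
by rewrite -(edge_class_set2 Dtri fE xy) // sep.
Qed.

Lemma exit_step (P : pred nat) i n : i <= n -> P i -> ~~ P n ->
  exists2 j, i <= j < n & P j && ~~ P j.+1.
Proof.
move=> + Pi; elim: n => [|n IH]; first by rewrite leqn0 => /eqP <-; rewrite Pi.
rewrite leq_eqVlt => /predU1P[<-|]; first by rewrite Pi.
rewrite ltnS => le_in nPn.
have [Pn|/(IH le_in)[j /andP[ij jn] Pj]] := boolP (P n).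
  by exists n; rewrite ?le_in ?leqnn // Pn.
by exists j => //; rewrite ij ltnW.
Qed.

Lemma connect_exit (e : rel G) (A : {set G}) x y :
  connect e x y -> x \in A -> y \notin A -> exists u v, [/\ e u v, u \in A & v \notin A].
Proof.
case/connectP=> p pP -> xA; rewrite (last_nth x) => yA.
have [j /andP[_ jp] /andP[jA jA']] :=
  @exit_step (fun i => nth x (x :: p) i \in A) 0 (size p) (leq0n _) xA yA.
exists (nth x (x :: p) j), (nth x (x :: p) j.+1); split=> //.
by move/pathP: pP; apply.
Qed.

(* Otherwise the geodesic would pass through two edges of one class, that is,
   through three vertices of a triangle. *)
Lemma geodesic_through_class f a b u p : classes_separate -> f \in edges G ->
  a \in cls f -> b \in cls f -> a != b -> geodesic u p ->
  connect (avoid (cls f)) a u -> connect (avoid (cls f)) b (last u p) ->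
  [set a; b] \in path_edges u p.
Proof.
move=> sep fE af bf nab gp au bw; set R := avoid (cls f) in au bw.
have uniq_in := connect_avoid_class sep fE.
have Csym := connect_avoid_sym (cls f); rewrite -/R in Csym uniq_in.
have /andP[pP _] := gp; pose q i := nth u (u :: p) i.
have qadj i : i < size p -> adj (q i) (q i.+1) by move=> ip; move/pathP: pP; apply.
have qlast : q (size p) = last u p by rewrite (last_nth u).
have na : ~~ connect R a (q (size p)).
  rewrite qlast; apply/negP=> aw; move/negP: nab; apply.
  by apply/eqP/uniq_in => //; apply: connect_trans aw _; rewrite Csym.
(* The geodesic leaves the component of [a] along an edge of the class, and [a] is the only class
   vertex in that component. *)
have [i /andP[_ ip] /andP[ai nai]] :=
  @exit_step (fun i => connect R a (q i)) 0 _ (leq0n _) au na.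
have [iS i1S] : q i \in cls f /\ q i.+1 \in cls f.
  apply: not_avoid (qadj _ ip) _; apply: contra nai => /connect1.
  exact: connect_trans.
have ea : a = q i by apply: uniq_in.
have [eb|nb] := eqVneq (q i.+1) b.
  by apply/path_edgesP; exists i => //; rewrite ea -eb.
(* Otherwise it enters the component of [b] by a later class edge, ending at [b], and the adjacent
   vertices [a] and [b] are at least two steps apart on it. *)
have [||j /andP[ij jp] /andP[nj]] :=
  @exit_step (fun j => ~~ connect R b (q j)) i.+1 (size p) ip.
- by apply: contra nb => bi; apply/eqP/esym/uniq_in.
- by rewrite negbK qlast.
rewrite negbK => bj1.
have [jS j1S] : q j \in cls f /\ q j.+1 \in cls f.
  apply: not_avoid (qadj _ jp) _; apply: contra nj; rewrite -/R => jj.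
  by apply: connect_trans bj1 _; rewrite Csym connect1.
have eb : b = q j.+1 by apply: uniq_in.
have := @geodesic_nth _ Gc u p i j.+1 gp.
have := edge_class_clique Dtri fE af bf nab => /(dist_adj Gc).
rewrite -/(q i) -/(q j.+1) -ea -eb => ->; rewrite jp andbT.
by move: ij; clear; lia.
Qed.

(* A chosen edge of each class: a bridge, or the edge of a triangle opposite to
   a vertex of degree two. *)
Definition core_edge f := (f \in edges G) &&
  [forall x in cls f, (x \notin f) ==> [forall z, adj x z ==> (z \in cls f)]].

(** Some class vertex [s] has [v] and [w] in its component. If [s] were not on [f], all its edges
    would be in the class and its component would be [s] alone. *)
Lemma core_edge_side f v w : core_edge f -> adj v w -> cls [set v; w] != cls f ->
  exists2 s, s \in f &
    connect (avoid (cls f)) s v /\ connect (avoid (cls f)) s w.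
Proof.
case/andP=> fE /forall_inP core vw ncl.
have [a [b [ab ef]]] := edgesP _ fE.
have af : a \in f by rewrite ef set21.
have aS : a \in cls f by rewrite (subsetP (sub_edge_class _ _)).
have [s sS sv] : exists2 s, s \in cls f & connect (avoid (cls f)) s v.
  have /connectP[p] := forallP (forallP Gc a) v.
  (* Along a walk from [a], [s] is kept until an edge of the class is traversed; the end of that
     edge is the new [s]. *)
  elim/last_ind: p v {vw ncl} => [|p y IH] v /=; first by move=> _ ->; exists a.
  rewrite rcons_path last_rcons => /andP[pP py] ->.
  have [s sS sl] := IH _ pP erefl.
  have [av|nav] := boolP (avoid (cls f) (last a p) y).
    by exists s => //; apply: connect_trans sl (connect1 av).
  by exists y; [have [] := not_avoid py nav | exact: connect0].
have sw : connect (avoid (cls f)) s w.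
  by apply: connect_trans sv (connect1 _); rewrite avoidE vw ncl.
exists s => //; apply/negPn/negP=> sf.
have stuck z : connect (avoid (cls f)) s z -> z = s.
  case/connectP=> [[|y p]] //= /andP[/[dup] avs /andP[sy _] _] _.
  have /implyP/(_ sf)/forallP/(_ y)/implyP/(_ sy) yS := core s sS.
  by rewrite avoid_in_class in avs.
by move: vw; rewrite (stuck _ sv) (stuck _ sw) adj_irrefl.
Qed.

(** Let [b] be the end of [f] on the side of [g], and [v] the end of [g] on the side of [f].
    Geodesics between the far ends [a] and [w] traverse both edges. *)
Lemma core_edges_on_geodesics f g : classes_separate ->
  core_edge f -> core_edge g -> cls f != cls g ->
  exists u v, forall p, geodesic u p -> last u p = v ->
    f \in path_edges u p /\ g \in path_edges u p.
Proof.
move=> sep cf cg nfg; have /andP[fE _] := cf; have /andP[gE _] := cg.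
have side h k : core_edge h -> core_edge k -> cls h != cls k ->
    exists s t, [/\ h = [set s; t], s != t &
      {in k, forall z, connect (avoid (cls h)) s z}].
  move=> ch ck nhk; have /andP[hE _] := ch; have /andP[kE _] := ck.
  have [v [w [vw ek]]] := edgesP _ kE.
  have [|s sh [sv sw]] := core_edge_side ch vw; first by rewrite -ek eq_sym.
  have [x [y [xy eh]]] := edgesP _ hE.
  have kz z : z \in k -> connect (avoid (cls h)) s z by rewrite ek => /set2P[]->.
  move: sh; rewrite eh => /set2P[] es; [exists x, y|exists y, x]; split; auto.
  - by rewrite adj_neq.
  - by move=> z zk; rewrite -eh -es kz.
  - by rewrite setUC.
  - by rewrite eq_sym adj_neq.
  - by move=> z zk; rewrite -eh -es kz.
have [b [a [ef nba bg]]] := side f g cf cg nfg.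
have [|v [w [eg nvw vf]]] := side g f cg cf; first by rewrite eq_sym.
have mf x : x \in f -> x \in cls f by apply/subsetP/sub_edge_class.
have mg x : x \in g -> x \in cls g by apply/subsetP/sub_edge_class.
have [bf af] : b \in f /\ a \in f by rewrite ef set21 set22.
have [vg wg] : v \in g /\ w \in g by rewrite eg set21 set22.
exists a, w => p gp pw; split.
- rewrite ef setUC; apply: (geodesic_through_class sep fE) => //; auto.
    by rewrite eq_sym.
  by rewrite pw bg.
- rewrite eg; apply: (geodesic_through_class sep gE) => //; auto.
  by rewrite pw.
Qed.

Lemma classes_le_src : classes_separate ->
  (forall T, T \in D -> exists2 x, x \in T & degree x = 2) ->
  #|classes D| <= src Gc.
Proof.
move=> sep Ddeg.
have coreP S : S \in classes D -> exists2 f, core_edge f & cls f = S.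
  case/imsetP=> f fE eS.
  move: (eS); case: edge_classP => [T TD fT|N] {}eS; last first.
    exists f; last by rewrite eS; case: edge_classP => // T /N/negP.
    rewrite /core_edge fE; apply/forall_inP=> x.
    by case: edge_classP => [T /N/negP//|_ ->].
  have [x xT dx] := Ddeg T TD; have tT := Dtri.1 _ TD.
  have /cards2P[y [z [nyz eyz]]] : #|T :\ x| == 2 by rewrite card_triangleD1.
  have [/setD1P[_ yT] /setD1P[_ zT]] : y \in T :\ x /\ z \in T :\ x.
    by rewrite eyz set21 set22.
  have yzE : [set y; z] \in edges G by rewrite edge_set2 (triangle_clique tT).
  have cT : cls [set y; z] = T.
    by apply: edge_class_triangle; rewrite // -eyz subD1set.
  exists [set y; z]; last by rewrite cT.
  rewrite /core_edge yzE cT -eyz; apply/forall_inP=> w wT.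
  rewrite !inE wT andbT negbK; apply/implyP=> /eqP->.
  by apply/forallP=> v; apply/implyP; apply: degree2_triangle.
rewrite /src; case: ex_minnP => k /existsP[c cP] _.
pose r S := odflt set0 [pick f | core_edge f && (cls f == S)].
have rP S : S \in classes D -> core_edge (r S) /\ cls (r S) = S.
  move=> /coreP[f cf fS]; rewrite /r; case: pickP => [g /andP[? /eqP]//|/(_ f)].
  by rewrite cf fS eqxx.
(* [None] is the value at sets that are not edges, which the representatives [r S] never are. *)
pose col (f : {set G}) : option 'I_k := omap c (insub f).
have colI : {in classes D &, injective (fun S => col (r S))}.
  move=> S S' /rP[cf eS] /rP[cg eS'] /= ecol.
  apply/eqP/negPn/negP; rewrite -{1}eS -{1}eS' => nfg.
  have [u [v uvP]] := core_edges_on_geodesics sep cf cg nfg.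
  have /forallP/(_ v)/existsP[p /andP[/and3P[pP /eqP pv _]]] := forallP cP u.
  have gp : geodesic u p by rewrite /geodesic pP size_tuple pv eqxx.
  have [fp gp'] := uvP _ gp pv.
  have /andP[fE _] := cf; have /andP[gE _] := cg.
  move/forallP/(_ (Sub (r S) fE))/forallP/(_ (Sub (r S') gE))/implyP.
  rewrite !SubK fp gp' !andbT -val_eqE /= => H.
  move: ecol; rewrite /col !insubT /= => -[] /eqP; apply/negP/H.
  by apply: contraNneq nfg => ->.
have someI : injective (@Some 'I_k) by move=> i j [].
rewrite -(card_in_imset colI) -[k in _ <= k]card_ord -(card_imset _ someI).
apply: subset_leq_card; apply/subsetP=> _ /imsetP[S /rP[/andP[fE _] _] ->].
by rewrite /col insubT; apply: imset_f.
Qed.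

End Separation.

(** * Blocks *)

Section Nonseparable.
Variable G : sgraph.
Implicit Types (x y z v : G) (f W : {set G}) (s : seq G) (H : pregraph G).

Lemma sub_adj_sym H : symmetric (sub_adj H).
Proof. by move=> x y; rewrite /sub_adj /= setUC. Qed.

Lemma sub_adj_induced W x y : x \in W -> y \in W ->
  sub_adj (W, edges_in W) x y = adj x y.
Proof.
move=> xW yW; rewrite /sub_adj /= in_edges_in edge_set2.
by rewrite (_ : _ \subset _) ?andbT //; apply/subsetP=> z /set2P[]->.
Qed.

Lemma path_connect_sym (e : rel G) x s y z : symmetric e -> path e x s ->
  y \in x :: s -> z \in x :: s -> connect e y z.
Proof.
move=> esym xs ys zs; apply: (@connect_trans _ _ x); last exact: path_connect zs.
by rewrite (sym_connect_sym esym); apply: path_connect ys.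
Qed.

(** Rotated to start at a deleted vertex, the cycle leaves a path through the others. A single edge
    is covered as a cycle on two vertices. *)
Lemma cycle_nonseparable s : s != [::] -> cycle (@adj G) s -> uniq s ->
  nonseparable ([set x in s], edges_in [set x in s]).
Proof.
move=> s0 cs us; set W := [set x in s].
have rotE v : v \in s -> exists s', [/\ path (@adj G) v (rcons s' v),
    v \notin s' & forall x, (x \in W) = (x == v) || (x \in s')].
  move=> vs; have [i s' e] := rot_to vs; exists s'.
  have : cycle (@adj G) (v :: s') by rewrite -e rot_cycle.
  have : uniq (v :: s') by rewrite -e rot_uniq.
  by case/andP=> ? _ ?; split=> // x; rewrite inE -(mem_rot i) e in_cons.
apply/and3P; split.
- apply/andP; split=> /=.
    by apply/subsetP=> f; rewrite in_edges_in => /andP[].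
  by apply/forall_inP=> f; rewrite in_edges_in => /andP[].
- apply/andP; split.
    by case: (s) s0 @W rotE => // x ? _ W _; apply/set0Pn; exists x; rewrite inE mem_head.
  apply/forall_inP=> x xW; apply/forall_inP=> y yW.
  have /rotE[s' [p _ memW]] : x \in s by rewrite inE in xW.
  have p' : path (sub_adj (W, edges_in W)) x s'.
    move: p; rewrite rcons_path => /andP[+ _].
    apply: (@sub_in_path _ [in W]) => [u v uW vW|]; first by rewrite sub_adj_induced.
    by apply/allP=> z zs /=; rewrite memW -in_cons.
  by apply: (path_connect_sym (@sub_adj_sym _) p'); rewrite in_cons -memW.
apply/forallP=> v; rewrite /cut_vertex negb_and -implybE /=; apply/implyP=> vW.
have /rotE[s' [p vs' memW]] : v \in s by rewrite inE in vW.
apply/negP=> /exists_inP[x /setD1P[nxv xW] /exists_inP[y /setD1P[nyv yW]]].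
case/andP=> _ /negP; apply.
move: xW yW; rewrite !memW (negPf nxv) (negPf nyv) /=.
case: s' p vs' memW => // z s' /= /andP[_ p] vs' memW xs ys.
apply: (@path_connect_sym _ z s') xs ys; first exact: sub_adj_sym.
move: p; rewrite rcons_path => /andP[+ _].
apply: (@sub_in_path _ [in z :: s']) => [u w zu zw uw|]; last exact/allP.
have inW t : t \in z :: s' -> t \in W by move=> ts; rewrite memW ts orbT.
apply/setIdP; split.
  by rewrite -[_ \in _]/(sub_adj (W, edges_in W) u w) sub_adj_induced ?inW.
by rewrite !inE negb_or; apply/andP; split; apply: contraNneq vs' => ->.
Qed.

(** A nonseparable subgraph containing [H] with the most vertices and edges in total is maximal for
    inclusion. *)
Lemma block_extension H : nonseparable H ->
  exists H', [/\ block H', H.1 \subset H'.1 & H.2 \subset H'.2].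
Proof.
move=> nH; pose P (K : {set G} * {set {set G}}) :=
  [&& nonseparable K, H.1 \subset K.1 & H.2 \subset K.2].
have PH : P H by rewrite /P nH !subxx.
case: (arg_maxnP (fun K : {set G} * {set {set G}} => #|K.1| + #|K.2|) PH).
move=> K /and3P[nK HK1 HK2] maxK; exists K; split=> //; split=> // K' nK' KK1 KK2.
have := geq_leqif (leqif_add (subset_leqif_cards KK1) (subset_leqif_cards KK2)).
rewrite [_ <= _]maxK ?/P ?nK' ?(subset_trans HK1 KK1) ?(subset_trans HK2 KK2) //.
by case: K K' {maxK nK HK1 HK2 nK' KK1 KK2} => ? ? [? ?] /= /esym/andP[/eqP-> /eqP->].
Qed.

End Nonseparable.

(** * Blocks and edge classes *)

Section Blocks.
Variables (G : sgraph) (D : {set {set G}}).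
Hypothesis (Dtri : edge_disjoint_triangles D).
Hypothesis (Gc : connected G).
Implicit Types (x y z : G) (f S T : {set G}) (H : pregraph G).
Local Notation cls := (edge_class D).
Local Notation avoid := (avoid D).

Definition class_block f : pregraph G := (cls f, edges_in (cls f)).

Lemma class_block_nonseparable f : f \in edges G -> nonseparable (class_block f).
Proof.
move=> fE; rewrite /class_block.
have cyc s : s != [::] -> cycle (@adj G) s -> uniq s -> cls f = [set x in s] ->
    nonseparable (cls f, edges_in (cls f)).
  by move=> ? ? ? ->; apply: cycle_nonseparable.
move: cyc; case: edge_classP => [T TD _|_] cyc.
  have /triangleP[a [b [c [ab bc ac eT]]]] := Dtri.1 _ TD.
  apply: (cyc [:: a; b; c]) => //=.
  - by rewrite ab bc adj_sym ac.
  - by rewrite !inE negb_or !adj_neq.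
  - by rewrite eT; apply/setP=> z; rewrite !inE orbA.
have [a [b [ab ef]]] := edgesP _ fE.
apply: (cyc [:: a; b]) => //=.
- by rewrite ab adj_sym ab.
- by rewrite !inE adj_neq.
- by rewrite ef; apply/setP=> z; rewrite !inE.
Qed.

(* A cycle through [ab] leaving the class of [ab] would lie in one block. *)
Lemma blocks_classes_separate :
  (forall T, triangle T -> T \in D) ->
  (forall H, block H -> (exists2 f, bridge f & H = (f, [set f])) \/
                        (exists2 T, triangle T & H = (T, edges_in T))) ->
  classes_separate D.
Proof.
move=> all_in_D blk a b ab; apply/negP=> /connectP[p0 p0P].
case/shortenP: p0P => p pP pU _ eb.
have abE : [set a; b] \in edges G by rewrite edge_set2.
have cyc : cycle (@adj G) (a :: p).
  rewrite /cycle rcons_path -eb [adj b a]adj_sym ab andbT.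
  by apply: sub_path pP => x y /andP[].
have [H [bH + _]] := block_extension (@cycle_nonseparable _ (a :: p) isT cyc pU).
rewrite /= => /subsetP sH.
have aH : a \in H.1 by rewrite sH // inE mem_head.
have bH1 : b \in H.1 by rewrite sH // inE eb mem_last.
have HS : H.1 \subset cls [set a; b].
  case: (blk H bH) aH bH1 => [[f /andP[fE _] ->]|[T tT ->]] /= aH bH1.
    by rewrite (edge_eq_set2 fE aH bH1 (adj_neq ab)) sub_edge_class.
  rewrite (edge_class_triangle Dtri abE (all_in_D _ tT)) //.
  by apply/subsetP=> z /set2P[]->.
(* The second vertex [z] of the cycle is in the class too, although the edge [az] avoids it. *)
case: p pP eb sH {p0 cyc pU} => [_ eb _|z p /= /andP[az _] _ sH].
  by rewrite eb adj_irrefl in ab.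
have zH : z \in H.1 by rewrite sH // !inE eqxx orbT.
by move: az; rewrite (avoid_in_class Dtri) ?mem_class1 ?(subsetP HS).
Qed.

Lemma edges_in_edge f : f \in edges G -> edges_in f = [set f].
Proof.
move=> fE; apply/setP=> g; rewrite in_edges_in in_set1.
apply/andP/eqP=> [[gE gf]|->]; last by rewrite fE.
by apply/eqP; rewrite eqEcard gf !card_edge.
Qed.

(** If a block containing [f] left the class of [f] at a vertex [u], then [u] would be a cut vertex
    of it. *)
Lemma block_class : 1 < #|G| -> classes_separate D ->
  forall H, block H -> exists2 f, f \in edges G & H = class_block f.
Proof.
move=> G2 sep H [nH maxH].
have := nH; case/and3P=> /andP[/subsetP H2E /forall_inP H2s] /andP[].
case/set0Pn=> x xH /forall_inP conn /forallP nocut.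
have Hconn y z : y \in H.1 -> z \in H.1 -> connect (sub_adj H) y z.
  by move=> yH zH; move/forall_inP: (conn y yH); apply.
have sub_block f : f \in edges G -> H.1 \subset cls f -> H = class_block f.
  move=> fE Hf; apply/esym/maxH => //; first exact: class_block_nonseparable.
  apply/subsetP=> g gH; rewrite in_edges_in H2E //=.
  exact: subset_trans (H2s g gH) Hf.
have [H0|[f fH]] := set_0Vmem H.2.
  (* An edgeless block would be a single vertex; having a neighbour, it lies in a class. *)
  have [y xy] : exists y, adj x y.
    have /card_gt0P[y /setD1P[nyx _]] : 0 < #|[set: G] :\ x|.
      by have := cardsD1 x [set: G]; rewrite inE cardsT; move: G2; clear; lia.
    by have [|z xz _] := @dist_first_step _ Gc x y; [rewrite eq_sym|exists z].
  exists [set x; y]; rewrite ?edge_set2 //; apply: sub_block; rewrite ?edge_set2 //.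
  apply/subsetP=> z /(Hconn x z xH)/connectP[[_ ->|w p /andP[]]].
    exact: mem_class1.
  by rewrite /sub_adj /= H0 inE.
have fE := H2E f fH; exists f => //; apply: sub_block => //.
apply/subsetP=> y yH; apply/negPn/negP=> yf.
have [x0 [x1 [x01 ef]]] := edgesP _ fE.
have fS z : z \in f -> z \in cls f by apply/subsetP/sub_edge_class.
have fH1 z : z \in f -> z \in H.1 by apply/subsetP/H2s.
have x0f : x0 \in f by rewrite ef set21.
have x1f : x1 \in f by rewrite ef set22.
have [u [v [uv uS vS]]] := connect_exit (Hconn _ _ (fH1 _ x0f) yH) (fS _ x0f) yf.
have uvE := H2E _ uv; have auv : adj u v by rewrite -edge_set2.
have [uH vH] : u \in H.1 /\ v \in H.1.
  by split; apply: (subsetP (H2s _ uv)); rewrite ?set21 ?set22.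
have [x' x'f nx'u] : exists2 x', x' \in f & x' != u.
  have [e|ne] := eqVneq x0 u; last by exists x0.
  by exists x1; rewrite // -e eq_sym adj_neq.
have nvu : v != u by rewrite eq_sym adj_neq.
have cvx : connect (sub_adj (del_vertex H u)) v x'.
  have := nocut u; rewrite /cut_vertex uH /= => /exists_inPn/(_ v).
  rewrite !inE nvu vH => /(_ isT)/exists_inPn/(_ x').
  rewrite !inE nx'u fH1 // => /(_ isT).
  by rewrite (Hconn v x' vH (fH1 _ x'f)) /= negbK.
have Z0 : connect (avoid (cls f)) u v.
  apply: connect1; rewrite avoidE auv; apply: contraNneq vS => <-.
  exact: mem_class2.
(* The walk from [v] to [x'] leaves the component of [u] by an edge [wz] of the class. Then [w] is a
   class vertex in the component of [u], hence [u] itself, which was deleted. *)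
have [|//|w [z [wz]]] := @connect_exit _ _ [set z | connect (avoid (cls f)) u z] _ _ cvx.
- by rewrite inE.
- rewrite inE; apply: contra nx'u => /(connect_avoid_class Dtri sep fE uS).
  by move=> ->; rewrite ?fS.
rewrite !inE => uw /negP; apply.
move: wz; rewrite /sub_adj /= inE !inE negb_or => /andP[wzH /andP[nuw nuz]].
have wzE := H2E _ wzH; rewrite edge_set2 in wzE.
have [a|na] := boolP (avoid (cls f) w z); first exact: connect_trans uw (connect1 a).
have [wS _] := not_avoid wzE na.
by rewrite (connect_avoid_class Dtri sep fE uS wS uw) eqxx in nuw.
Qed.

(** The class consists of [f] alone, so avoiding it amounts to deleting [f]. *)
Lemma class_edge_bridge f : f \in edges G -> classes_separate D ->
  cls f = f -> bridge f.
Proof.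
move=> fE sep ef; rewrite /bridge fE /=.
have [a [b [ab eab]]] := edgesP _ fE.
apply/exists_inP; exists a; first by rewrite inE.
apply/exists_inP; exists b; first by rewrite inE.
rewrite connect1 /=; last by rewrite /sub_adj /= edge_set2.
have := sep a b ab; rewrite -eab ef; apply: contra.
apply: connect_sub => x y; rewrite /sub_adj /= in_setD1 => /andP[nxy xyE].
apply: connect1; rewrite avoidE -edge_set2 xyE; apply: contraNneq nxy => e.
have : [set x; y] \in edges_in f by rewrite in_edges_in xyE -e sub_edge_class.
by rewrite edges_in_edge // inE.
Qed.

End Blocks.

(** * The bound and the case of equality *)

Theorem theorem4p1 (G : sgraph) (m t : nat)
  (Gnontrivial : 1 < #|G|)
  (Gc : connected G)
  (Gm : #|edges G| = m)
  (Gt : exists2 D : {set {set G}}, edge_disjoint_triangles D & #|D| = t) :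
  src Gc <= m - 2 * t /\ (src Gc = m - 2 * t <-> class_Gbar t G).
Proof.
case: Gt => D Dtri Dt; have le := src_le Dtri Gc.
split; first by move: le; rewrite Gm Dt; clear; lia.
split=> [es|[_ blk nt deg2]].
  (* Under equality no color can be saved, which excludes the three situations one by one. *)
  have nlt : ~ (src Gc + 2 * #|D| < #|edges G|).
    by move: le; rewrite es Gm Dt; clear; lia.
  have all_in_D T : triangle T -> T \in D.
    by move=> tT; apply/negPn/negP=> /(src_lt_triangle_notin Dtri Gc tT)/nlt.
  have deg2 T : T \in D -> exists2 x, x \in T & degree x = 2.
    move=> TD; have tT := Dtri.1 _ TD.
    case: (boolP [exists x in T, degree x == 2]) => [/exists_inP[x xT /eqP dx]|N].
      by exists x.
    case: nlt; apply: (src_lt_triangle_degree Dtri Gc TD) => x xT.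
    have dx : degree x != 2 by move/exists_inPn: N; apply.
    (* The other two vertices of [T] are neighbours of [x]; its degree is not 2, so it has a further
       one. *)
    have : ~~ ([set y | adj x y] \subset T :\ x).
      apply: contra dx => sub; rewrite eqn_leq.
      rewrite -(card_triangleD1 tT xT) [X in X && _]subset_leq_card // subset_leq_card //.
      apply/subsetP=> y /setD1P[nyx yT].
      by rewrite inE (triangle_clique tT) // eq_sym.
    case/subsetPn=> y; rewrite !inE => xy; rewrite negb_and negbK.
    case/orP=> [/eqP e|yT]; first by rewrite e adj_irrefl in xy.
    by exists y.
  have [sep|//] := src_lt_not_separate Dtri Gc all_in_D deg2.
  split=> // [H bH||T tT]; last exact: deg2 (all_in_D _ tT).
    have [f fE ->] := block_class Dtri Gc Gnontrivial sep bH.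
    rewrite /class_block; have := class_edge_bridge fE sep.
    case: edge_classP => [T TD _ _|_ br]; [right; exists T|left; exists f] => //.
    - exact: Dtri.1.
    - exact: br.
    - by rewrite edges_in_edge.
  rewrite -Dt; apply: eq_card => T; rewrite inE.
  by apply/idP/idP; [exact: all_in_D | exact: Dtri.1].
(* [D] consists of triangles and has as many members as there are triangles. *)
have eD : D = [set T | triangle T].
  apply/eqP; rewrite eqEcard nt Dt leqnn andbT.
  by apply/subsetP=> T TD; rewrite inE Dtri.1.
have all_in_D T : triangle T -> T \in D by rewrite eD inE.
have sep := blocks_classes_separate Dtri all_in_D blk.
have := classes_le_src Dtri Gc sep (fun T TD => deg2 T (Dtri.1 T TD)).
by have := card_classes Dtri; move: le; rewrite Gm Dt; clear; lia.
Qed.
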